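(* Fix a subgroup $G\subset\mathbb{C}^\times$, an integer $N\ge1$, and a non-zero matrix $A\in\mathcal{P}_N(\mathbb{C})$. (1) Suppose $\{I_1,\dots,I_k\}$ is a partition of $\{1,\dots,N\}$ satisfying the following two conditions. (a) Each diagonal block $A_{I_j}$ of $A$ is a submatrix having rank at most one, and $A_{I_j}=\mathbf{u}_j\mathbf{u}_j^*$ for a unique $\mathbf{u}_j\in\mathbb{C}^{|I_j|}$ with first entry $\mathbf{u}_{j,1}\in[0,\infty)$. (b) The entries of each diagonal block $A_{I_j}$ lie in a single $G$-orbit. Then there exists a unique $k\times k$ matrix $C=(c_{ij})_{i,j=1}^k$ such that $c_{ij}=0$ unless $\mathbf{u}_i\ne0$ and $\mathbf{u}_j\ne0$, and $A$ is a block matrix with $$A_{I_i\times I_j}=c_{ij}\mathbf{u}_i\mathbf{u}_j^*\qquad(1\le i,j\le k).$$ Moreover, the entries of each off-diagonal block $A_{I_i\times I_j}$ of $A$ also lie in a single $G$-orbit. Furthermore, $C\in\mathcal{P}_k(\overline{D}(0,1))$, and the matrices $A$ and $C$ have equal rank. (2) If the following condition (c) is assumed as well as (a) and (b), then such a partition $\{I_1,\dots,I_k\}$ exists and is unique up to relabelling of the indices. (c) The diagonal blocks of $A$ have maximal size, i.e. no $I_j$ is properly contained in a set $J\subset\{1,\dots,N\}$ such that $A_J$ has rank at most one and its entries lie in a single $G$-orbit. (3) Suppose (a)–(c) hold and $G=\mathbb{C}^\times$. Then the off-diagonal entries of $C$ lie in the open disc $D(0,1)$.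
   Context: $\mathbb{C}^\times$ is the multiplicative group of non-zero complex numbers; $G$ acts on $\mathbb{C}$ by multiplication, so the $G$-orbits are the sets $\alpha\cdot G$, $\alpha\in\mathbb{C}$ (in particular $\{0\}$ is an orbit). $\mathcal{P}_N(K)$ is the set of positive semidefinite $N\times N$ matrices with entries in $K\subset\mathbb{C}$. $D(0,1)$ and $\overline{D}(0,1)$ are the open and closed unit discs in $\mathbb{C}$. For $I,J\subset\{1,\dots,N\}$, $A_{I\times J}$ is the submatrix of $A$ with rows in $I$ and columns in $J$, and $A_I:=A_{I\times I}$; entries of vectors in $\mathbb{C}^{|I|}$ are indexed by the elements of $I$ in increasing order. *)

(* Defs.v *)
From mathcomp Require Import all_boot all_order all_algebra.
From mathcomp Require Import boolp classical_sets reals.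
From mathcomp Require Import complex.

Set Implicit Arguments.
Unset Strict Implicit.
Unset Printing Implicit Defensive.

Import Order.TTheory GRing.Theory Num.Theory.

Local Open Scope ring_scope.
Local Open Scope classical_set_scope.
Local Open Scope sesquilinear_scope.

(* The order of [R[i]] is partial: [0 <= z] says that [z] is real and
   nonnegative.  [M ^t*] is the conjugate transpose. *)

Section Complex.
Variable R : realType.
Local Notation C := R[i].

Definition nonzero_complex : set C := [set z | z != 0].

Definition open_unit_disc : set C := [set z | `|z| < 1].

Definition closed_unit_disc : set C := [set z | `|z| <= 1].

Definition mul_subgroup (G : set C) : Prop :=
  [/\ G `<=` nonzero_complex, G 1,
      forall x y, G x -> G y -> G (x * y)
    & forall x, G x -> G x^-1].

Definition orbit_of (G : set C) (a : C) : set C := [set a * g | g in G].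

Definition in_single_orbit (G : set C) m n (B : 'M[C]_(m, n)) : Prop :=
  exists a : C, forall i j, orbit_of G a (B i j).

Definition psd_over (K : set C) n (A : 'M[C]_n) : Prop :=
  [/\ forall i j, K (A i j), A ^t* = A
    & forall v : 'cV[C]_n, 0 <= (v ^t* *m A *m v) 0 0].

(* [enum_val] lists a set of ordinals in increasing order. *)
Definition subblock N (A : 'M[C]_N) (I J : {set 'I_N}) : 'M[C]_(#|I|, #|J|) :=
  mxsub (@enum_val _ (mem I)) (@enum_val _ (mem J)) A.

(* The side condition on [p] selects the first entry without assuming that the
   length [n] is a successor. *)
Definition normalized_factor n (B : 'M[C]_n) (u : 'cV[C]_n) : Prop :=
  B = u *m u ^t* /\ (forall p : 'I_n, p = 0%N :> nat -> 0 <= u p 0).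

Definition family_partition N k (I : 'I_k -> {set 'I_N}) : Prop :=
  injective I /\ finset.partition [set I j | j : 'I_k]%SET [set: 'I_N]%SET.

Section Blocks.
Variables (G : set C) (N : nat) (A : 'M[C]_N) (k : nat).
Variable I : 'I_k -> {set 'I_N}.

Definition rank_one_blocks (u : forall j : 'I_k, 'cV[C]_#|I j|) : Prop :=
  forall j, (\rank (subblock A (I j) (I j)) <= 1)%N /\
            unique (normalized_factor (subblock A (I j) (I j))) (u j).

Definition single_orbit_blocks : Prop :=
  forall j, in_single_orbit G (subblock A (I j) (I j)).

Definition maximal_blocks : Prop :=
  forall j, ~ exists J : {set 'I_N},
    [/\ I j \proper J, (\rank (subblock A J J) <= 1)%N
      & in_single_orbit G (subblock A J J)].

Definition block_coefficients (u : forall j : 'I_k, 'cV[C]_#|I j|)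
    (c : 'M[C]_k) : Prop :=
  (forall i j, ~ (u i != 0 /\ u j != 0) -> c i j = 0) /\
  (forall i j, subblock A (I i) (I j) = c i j *: (u i *m (u j) ^t*)).

End Blocks.

End Complex.

(* Main.v *)
Require Import Defs.
From mathcomp Require Import all_boot all_order all_algebra.
From mathcomp Require Import boolp classical_sets reals.
From mathcomp Require Import complex ring.

(** The whole statement is governed by one equivalence relation on indices.
    Call [p] and [q] row-equivalent when row [p] of [A] is [g] times row [q]
    for some [g] such that both [g] and its conjugate lie in [G]; this is
    visibly an equivalence relation, and since [A] is Hermitian the columns
    are then proportional with multiplier the conjugate of [g].

    The link with blocks is [homogeneousP]: a diagonal block has rank at most
    one and its entries in one orbit exactly when its indices are pairwise
    row-equivalent.  The only analytic input is the Cauchy-Schwarz inequality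
    for a positive semidefinite form.  It implies that a null vector of the
    form is in the kernel of [A], so a vanishing principal 2x2 minor makes two
    complete rows of [A] proportional, not merely their entries in the block.

    Consequently the maximal blocks are the row-equivalence classes, which
    gives their existence and uniqueness.  For an arbitrary partition into
    such blocks, an entry of [A] in the block [(i, j)] is the entry at chosen
    representatives times a multiplier of the row and a conjugate multiplier
    of the column.  The same multipliers relate the entries of the vectors
    [u i], which yields both the block factorization and the single orbit.
    With [U] the matrix whose column [i] is [u i] placed on [I i], this reads
    [A = U c U^*], while [c = X A X^*] for a matrix [X] that selects and
    rescales the representatives.  Hence [c] is positive semidefinite and has
    the rank of [A]; its diagonal entries are 0 or 1, so Cauchy-Schwarz puts
    its entries in the closed disc.  When [G] contains all non-zero numbers,
    a coefficient of modulus one would give a vanishing minor between two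
    blocks, hence would make two distinct classes equivalent. *)

Set Implicit Arguments.
Unset Strict Implicit.
Unset Printing Implicit Defensive.

Import Order.TTheory GRing.Theory Num.Theory.

Local Open Scope ring_scope.
Local Open Scope sesquilinear_scope.

(** * Positive semidefinite matrices *)

Section PositiveSemidefinite.
Variables (C : numClosedFieldType) (n : nat) (A : 'M[C]_n).
Hypothesis hermA : A ^t* = A.
Hypothesis posA : forall v : 'cV[C]_n, 0 <= (v ^t* *m A *m v) 0 0.

Let form (x y : 'cV[C]_n) : C := (x ^t* *m A *m y) 0 0.

Lemma herm_entry p q : A q p = (A p q)^*.
Proof. by rewrite -[in LHS]hermA !mxE. Qed.

Lemma form_conj x y : form y x = (form x y)^*.
Proof.
have -> : (form x y)^* = ((x ^t* *m A *m y) ^t*) 0 0.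
  by rewrite [RHS]mxE; congr (_^*); rewrite [RHS]mxE.
rewrite !trmx_mul !map_mxM /= hermA mulmxA /form.
congr ((_ *m _ *m _) 0 0).
by apply/matrixP=> i j; rewrite !mxE conjCK.
Qed.

Lemma formDl a b x x' y :
  form (a *: x + b *: x') y = a^* * form x y + b^* * form x' y.
Proof.
by rewrite /form linearD !linearZ /= map_mxD !map_mxZ !mulmxDl -!scalemxAl !mxE.
Qed.

Lemma formDr a b x y y' :
  form x (a *: y + b *: y') = a * form x y + b * form x y'.
Proof. by rewrite /form mulmxDr -!scalemxAr !mxE. Qed.

(** The form is only semidefinite, so the discriminant argument needs the
    degenerate case [form y y = 0] as well.  The scalars are not totally
    ordered, hence explicit combinations of [x] and [y] are tested rather than
    minimizing a real quadratic. *)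
Lemma psd_CauchySchwarz x y : `|form x y| ^+ 2 <= form x x * form y y.
Proof.
have quad a b : 0 <= a * a^* * form x x + a * b^* * (form x y)^*
    + a^* * b * form x y + b * b^* * form y y.
  have := posA (a *: x + b *: y); rewrite -/(form _ _) formDl !formDr.
  rewrite (form_conj x y); congr (_ <= _); ring.
have xx_ge0 : 0 <= form x x by apply: posA.
have yy_ge0 : 0 <= form y y by apply: posA.
rewrite normCK; set z := form x y in quad *.
set a := form x x in quad xx_ge0 *; set b := form y y in quad yy_ge0 *.
have [b_eq0|b_neq0] := eqVneq b 0.
  rewrite b_eq0 mulr0; have [->|z_neq0] := eqVneq z 0; first by rewrite mul0r.
  have m_gt0 : 0 < z * z^* by rewrite -normCK exprn_gt0 ?normr_gt0.
  (* With [form y y = 0], the form at [x - s z^* y] is [a - 2 s |z|^2]; this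
     [s] makes it equal to -1. *)
  pose s : C := (a + 1) / (2 * (z * z^*)).
  have s_real : s^* = s.
    apply/CrealP; apply: ger0_real; rewrite divr_ge0 ?addr_ge0 ?ler01 //.
    by apply: mulr_ge0; rewrite ?ler0n // ltW.
  have := quad 1 (- s * z^*); rewrite b_eq0 mulr0 addr0.
  rewrite rmorphM rmorphN rmorph1 /= s_real conjCK.
  suff -> : 1 * 1 * a + 1 * (- s * z) * z^* + 1 * (- s * z^*) * z = -1.
    by rewrite oppr_ge0 ler10.
  rewrite /s; field; rewrite z_neq0 /=; move: m_gt0; rewrite lt0r mulf_eq0.
  by case: (z^* =P 0) => //; rewrite orbT.
have b_gt0 : 0 < b by rewrite lt0r b_neq0.
have b_real : b^* = b by apply/CrealP; apply: ger0_real.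
(* The combination [b x - z^* y] gives [b (a b - |z|^2)]. *)
have := quad b (- z^*); rewrite rmorphN /= conjCK b_real.
suff -> : b * b * a + b * - z * z^* + b * - z^* * z + - z^* * - z * b =
          b * (a * b - z * z^*) by rewrite pmulr_rge0 // subr_ge0.
ring.
Qed.

Let form_delta p q : form (delta_mx p 0) (delta_mx q 0) = A p q.
Proof. by rewrite /form trmx_delta map_delta_mx -rowE -colE !mxE. Qed.

Lemma psd_diag_ge0 p : 0 <= A p p.
Proof. by rewrite -form_delta; apply: posA. Qed.

Lemma psd_entry_CauchySchwarz p q : `|A p q| ^+ 2 <= A p p * A q q.
Proof. by rewrite -!form_delta; apply: psd_CauchySchwarz. Qed.

Lemma psd_diag_eq0 p q : A p p = 0 -> A p q = 0.
Proof.
move=> App; have := psd_entry_CauchySchwarz p q; rewrite App mul0r.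
by rewrite real_exprn_even_le0 ?normr_real //= normr_eq0 => /eqP ->.
Qed.

(** The vanishing minor provides a vector supported on [p] and [q] on which
    the form is zero; by Cauchy-Schwarz against the basis vectors it lies in
    the kernel of [A], which relates the whole rows [p] and [q]. *)
Lemma psd_minor_eq0 p q r :
  A p p * A q q = A p q * A q p -> A q q * A p r = A p q * A q r.
Proof.
move=> minor0.
pose v : 'cV_n := A q q *: delta_mx p 0 + (- A q p) *: delta_mx q 0.
have vAv : form v v = 0.
  rewrite formDl !formDr !form_delta rmorphN /= -!herm_entry.
  have -> : A q q * (A q q * A p p + - A q p * A p q)
    = A q q * (A p p * A q q - A p q * A q p) by ring.
  by rewrite minor0 subrr mulr0; ring.
have := psd_CauchySchwarz (delta_mx r 0) v; rewrite vAv mulr0.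
rewrite real_exprn_even_le0 ?normr_real //= normr_eq0 => /eqP.
rewrite formDr !form_delta => /eqP; rewrite mulNr subr_eq0 => /eqP /(congr1 Num.conj).
by rewrite !rmorphM /= -!herm_entry.
Qed.

End PositiveSemidefinite.

(** * Row equivalence and homogeneous blocks *)

Lemma rank_le1_minor (F : fieldType) m n (B : 'M[F]_(m, n)) i j k l :
  (\rank B <= 1)%N -> B i k * B j l = B i l * B j k.
Proof.
rewrite -{2 3 4 5}(mulmx_base B); move: (col_base B) (row_base B).
case: (\rank B) => [|[|//]] L M _; rewrite !mxE ?big_ord0 ?mul0r // !big_ord1.
ring.
Qed.

Lemma mem_enum_val (T : finType) (J : {set T}) p : p \in J ->
  exists i : 'I_#|J|, enum_val i = p.
Proof. by move=> pJ; exists (enum_rank_in pJ p); rewrite enum_rankK_in. Qed.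

Section RowEquivalence.
Variables (R : realType) (G : set R[i]) (N : nat) (A : 'M[R[i]]_N).
Hypotheses (hG : mul_subgroup G) (hA : psd_over setT A).

Let herm p q : A q p = (A p q)^*.
Proof. by case: hA => _ hermA _; apply: herm_entry. Qed.

(** The conjugate of the multiplier is required to be in [G] as well: it is
    the multiplier between the columns [p] and [q]. *)
Definition row_equiv p q : Prop :=
  exists g, [/\ G g, G g^* & forall r, A p r = g * A q r].

Let G_neq0 g : G g -> g != 0.
Proof. by case: hG => sub _ _ _ /sub. Qed.

Lemma row_equiv_refl p : row_equiv p p.
Proof.
by case: hG => _ G1 _ _; exists 1; split=> [||r]; rewrite ?conjC1 ?mul1r.
Qed.

Lemma row_equiv_sym p q : row_equiv p q -> row_equiv q p.
Proof.
case: hG => _ _ _ GV [g [Gg Gg' Apq]]; exists g^-1; split=> [||r]; first exact: GV.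
  by rewrite fmorphV; apply: GV.
by rewrite Apq mulKf // G_neq0.
Qed.

Lemma row_equiv_trans p q r : row_equiv p q -> row_equiv q r -> row_equiv p r.
Proof.
case: hG => _ _ GM _ [g [Gg Gg' Apq]] [h [Gh Gh' Aqr]]; exists (g * h).
by split=> [||s]; rewrite ?rmorphM /=; [exact: GM|exact: GM|rewrite Apq Aqr mulrA].
Qed.

(** The criterion that produces equivalences: the multiplier is
    [A p q / A q q], and its conjugate is [A q p / A q q]. *)
Lemma row_equiv_minor p q : A p p * A q q = A p q * A q p ->
  (A q q = 0 -> A p p = 0) ->
  (A q q != 0 -> G (A p q / A q q) /\ G (A q p / A q q)) ->
  row_equiv p q.
Proof.
case: (hA) => _ hermA posA minor0 diag0 quot.
have [Aqq0|Aqq_neq0] := eqVneq (A q q) 0.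
  case: (hG) => _ G1 _ _; exists 1; split=> [||r]; rewrite ?conjC1 ?mul1r //.
  by rewrite (psd_diag_eq0 hermA posA r Aqq0) (psd_diag_eq0 hermA posA r (diag0 Aqq0)).
have [Gpq Gqp] := quot Aqq_neq0.
exists (A p q / A q q); split=> // [|r].
  by rewrite rmorphM fmorphV /= -!herm.
apply: (mulfI Aqq_neq0); rewrite (psd_minor_eq0 hermA posA r minor0).
by field.
Qed.

(** From left to right, this is [row_equiv_minor].  From right to left, every
    entry of the block is a product of two multipliers by a fixed diagonal
    entry [a], so the block is a column times a row and lies in the orbit of
    [a]. *)
Lemma homogeneousP (J : {set 'I_N}) :
  (\rank (subblock A J J) <= 1)%N /\ in_single_orbit G (subblock A J J) <->
  {in J &, forall p q, row_equiv p q}.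
Proof.
case: (hG) => _ G1 GM GV; split=> [[rk [a orb]] p q pJ qJ|eqJ].
  have orbJ x y : x \in J -> y \in J -> exists2 g, G g & A x y = a * g.
    move=> /mem_enum_val[i <-] /mem_enum_val[j <-].
    by have [g Gg def_g] := orb i j; exists g; rewrite // def_g mxE.
  have minor0 : A p p * A q q = A p q * A q p.
    have [i <-] := mem_enum_val pJ; have [j <-] := mem_enum_val qJ.
    by have := rank_le1_minor i j i j rk; rewrite !mxE.
  have [gpp Gpp App] := orbJ _ _ pJ pJ; have [gqq Gqq Aqq] := orbJ _ _ qJ qJ.
  have [gpq Gpq Apq] := orbJ _ _ pJ qJ; have [gqp Gqp Aqp] := orbJ _ _ qJ pJ.
  apply: row_equiv_minor => //.
    rewrite Aqq => /eqP; rewrite mulf_eq0 (negPf (G_neq0 Gqq)) orbF => /eqP a0.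
    by rewrite App a0 mul0r.
  rewrite Aqq mulf_eq0 negb_or => /andP[a_neq0 _].
  by rewrite Apq Aqp -!mulf_div divff // !mul1r; split; apply: GM => //; apply: GV.
have [->|[p0 p0J]] := set_0Vmem J.
  split; last by exists 0 => i; have := enum_valP i; rewrite inE.
  by rewrite (leq_trans (rank_leq_row _)) // cards0.
pose a := A p0 p0.
have coefs p q : p \in J -> q \in J ->
    exists g h, [/\ G g, G h, A p p0 = g * a, A p0 q = h * a & A p q = a * (g * h)].
  move=> pJ qJ; have [g [Gg _ Ap]] := eqJ p p0 pJ p0J.
  have [h [_ Gh Aq]] := eqJ q p0 qJ p0J; exists g, h^*; split=> //.
    by rewrite herm Aq rmorphM /= -herm.
  by rewrite Ap herm Aq rmorphM /= -herm /a; ring.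
split; last first.
  exists a => i j; have [g [h [Gg Gh _ _ Aij]]] := coefs _ _ (enum_valP i) (enum_valP j).
  by exists (g * h); [apply: GM|rewrite mxE Aij].
have -> : subblock A J J = (\col_i A (enum_val i) p0) *m (\row_j (A p0 (enum_val j) / a)).
  apply/matrixP=> i j; rewrite !mxE big_ord1 !mxE.
  have [g [h [_ _ -> -> ->]]] := coefs _ _ (enum_valP i) (enum_valP j).
  have [->|a_neq0] := eqVneq a 0; first by rewrite !(mul0r, mulr0).
  by field.
exact: leq_trans (mulmx_max_rank _ _) _.
Qed.

Definition row_class p : {set 'I_N} := [set q | `[< row_equiv p q >]].

Lemma mem_row_class p : p \in row_class p.
Proof. by rewrite !inE; exact: row_equiv_refl. Qed.

Lemma row_class_homogeneous p : {in row_class p &, forall x y, row_equiv x y}.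
Proof.
move=> x y; rewrite !inE => px py.
exact: row_equiv_trans (row_equiv_sym px) py.
Qed.

End RowEquivalence.

(** The first column of [B] determines the factor: [u] must be that column
    divided by the square root of the first diagonal entry.  When that entry
    is 0 the hypothesis forces [B = 0], which again leaves only [u = 0]. *)
Lemma normalized_factor_unique (R : realType) n (B : 'M[R[i]]_n) (p0 : 'I_n) :
  p0 = 0%N :> nat -> B ^t* = B -> 0 <= B p0 p0 ->
  (forall p q, B p q = B p p0 * B p0 q / B p0 p0) ->
  exists u, unique (normalized_factor B) u.
Proof.
move=> p00 hermB a_ge0 Bpq; set a := B p0 p0 in a_ge0 Bpq.
have herm p q : B q p = (B p q)^* by apply: herm_entry.
have s_ge0 : 0 <= sqrtC a by rewrite sqrtC_ge0.
have s_real : (sqrtC a)^* = sqrtC a by apply/CrealP; apply: ger0_real.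
have s2 : sqrtC a * sqrtC a = a by rewrite -expr2 sqrtCK.
exists (\col_p (B p p0 / sqrtC a)); split.
  split.
    apply/matrixP=> p q; rewrite !mxE big_ord1 !mxE Bpq rmorphM fmorphV /= -herm.
    by rewrite s_real mulf_div s2.
  move=> p p_0; have -> : p = p0 by apply: val_inj; rewrite /= p_0 p00.
  by rewrite mxE -/a divr_ge0.
move=> y [By y_ge0]; apply/matrixP=> p j; rewrite (ord1 j) mxE.
have Byy q r : B q r = y q 0 * (y r 0)^* by rewrite By !mxE big_ord1 !mxE.
have y0_ge0 := y_ge0 p0 p00.
have y0 : y p0 0 = sqrtC a.
  rewrite /a Byy (CrealP _); last exact: ger0_real.
  by rewrite -expr2 sqrCK.
have [a0|a_neq0] := eqVneq a 0.
  have : `|y p 0| ^+ 2 == 0 by rewrite normCK -Byy Bpq a0 invr0 mulr0.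
  by rewrite expf_eq0 normr_eq0 /= => /eqP ->; rewrite a0 sqrtC0 invr0 mulr0.
by rewrite Byy y0 s_real mulfK // sqrtC_eq0.
Qed.

(** * Indexed partitions *)

Section FamilyPartition.
Variables (N k : nat) (I : 'I_k -> {set 'I_N}).
Hypothesis partI : family_partition I.

Lemma family_partition_cover p : exists i, p \in I i.
Proof.
case: partI => _ /and3P[/eqP cov _ _]; have: p \in finset.cover [set I j | j : 'I_k]%SET.
  by rewrite cov inE.
by case/bigcupP=> _ /imsetP[i _ ->]; exists i.
Qed.

Lemma family_partition_inj p i j : p \in I i -> p \in I j -> i = j.
Proof.
case: partI => injI /and3P[_ triv _] pi pj; apply: injI.
have block l : I l \in [set I j | j : 'I_k]%SET by apply: imset_f.
by rewrite -(def_pblock triv (block i) pi) -(def_pblock triv (block j) pj).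
Qed.

Lemma family_partition_neq0 i : exists p, p \in I i.
Proof.
case: partI => _ /and3P[_ _ no0]; apply/finset.set0Pn; apply: contra no0 => /eqP <-.
exact: imset_f.
Qed.

End FamilyPartition.

(** * The block factorization *)

Section BlockFactorization.
Variables (R : realType) (G : set R[i]) (N : nat) (A : 'M[R[i]]_N).
Hypotheses (hG : mul_subgroup G) (hA : psd_over setT A).
Variables (k : nat) (I : 'I_k -> {set 'I_N}) (u : forall j : 'I_k, 'cV[R[i]]_#|I j|).
Hypotheses (partI : family_partition I) (rank1 : rank_one_blocks A u).
Hypothesis orbI : single_orbit_blocks G A I.

(** Column [i] is [u i] extended by zero outside of [I i].  Entries of the
    blocks are thus addressed by indices of [A], which removes the dependent
    types of the [u i]; the sum has one term on [I i] and none elsewhere. *)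
Definition scatter : 'M[R[i]]_(N, k) :=
  \matrix_(p, i) \sum_(a | enum_val a == p) u i a 0.
Local Notation U := scatter.

Lemma scatter_enum_val i a : U (enum_val a) i = u i a 0.
Proof.
rewrite mxE (big_pred1 a) // => b.
exact: (inj_eq enum_val_inj).
Qed.

Lemma scatter_out p i : p \notin I i -> U p i = 0.
Proof.
move=> pNi; rewrite mxE big_pred0 // => a; apply: contraNF pNi => /eqP <-.
exact: enum_valP.
Qed.

Lemma scatter_factor p q i : p \in I i -> q \in I i ->
  A p q = U p i * (U q i)^*.
Proof.
move=> /mem_enum_val[a <-] /mem_enum_val[b <-]; rewrite !scatter_enum_val.
have [_ [[/matrixP/(_ a b) eqA _] _]] := rank1 i.
by move: eqA; rewrite !mxE big_ord1 !mxE.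
Qed.

Let row_equivI i p q : p \in I i -> q \in I i -> row_equiv G A p q.
Proof.
have [rk _] := rank1 i; have := orbI i => orb pi qi.
by have /(homogeneousP hG hA) := conj rk orb; apply.
Qed.

Let herm p q : A q p = (A p q)^*.
Proof. by case: hA => _ hermA _; apply: herm_entry. Qed.

(** The rows of [A] and the entries of [u i] share their multipliers.  This is
    cancellation in [A p q = U p i * (U q i)^*], except when [U q i = 0],
    where the diagonal entry at [p] has to vanish too. *)
Lemma scatter_multiplier i p q : p \in I i -> q \in I i ->
  exists g, [/\ G g, G g^*, forall r, A p r = g * A q r & U p i = g * U q i].
Proof.
move=> pi qi; have [g [Gg Gg' Apq]] := row_equivI pi qi; exists g; split=> //.
have [Uq0|Uq_neq0] := eqVneq (U q i) 0; last first.
  apply: (mulIf (_ : (U q i)^* != 0)); first by rewrite conjC_eq0.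
  by rewrite -scatter_factor // -mulrA -scatter_factor.
have Aqp : A q p = 0 by rewrite (scatter_factor qi pi) Uq0 mul0r.
have : `|U p i| ^+ 2 == 0 by rewrite normCK -scatter_factor // Apq Aqp mulr0.
by rewrite expf_eq0 normr_eq0 Uq0 mulr0 /= => /eqP.
Qed.

Lemma block_factorP (c : 'M[R[i]]_k) :
  (forall i j, subblock A (I i) (I j) = c i j *: (u i *m (u j) ^t*)) <->
  (forall i j p q, p \in I i -> q \in I j -> A p q = c i j * (U p i * (U q j)^*)).
Proof.
split=> [cA i j _ _ /mem_enum_val[a <-] /mem_enum_val[b <-]|cA i j].
  rewrite !scatter_enum_val; have /matrixP/(_ a b) := cA i j.
  by rewrite !mxE big_ord1 !mxE.
apply/matrixP=> a b; rewrite !mxE big_ord1 !mxE -!scatter_enum_val.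
by apply: cA; apply: enum_valP.
Qed.

Lemma block_vector_neq0 i : u i != 0 -> exists2 p, p \in I i & U p i != 0.
Proof.
move=> ui; have [a ua] : exists a, u i a 0 != 0.
  apply/existsP; apply: contraNT ui => /existsPn u0.
  by apply/eqP/matrixP=> a j; rewrite (ord1 j) mxE; apply/eqP; rewrite -[_ == _]negbK.
by exists (enum_val a); rewrite ?enum_valP ?scatter_enum_val.
Qed.

Lemma block_coefficients_unique (c c' : 'M[R[i]]_k) :
  block_coefficients A u c -> block_coefficients A u c' -> c = c'.
Proof.
move=> [c0 /block_factorP cA] [c0' /block_factorP cA']; apply/matrixP=> i j.
have [/andP[ui uj]|uij0] := boolP ((u i != 0) && (u j != 0)); last first.
  by rewrite c0 ?c0' // => /andP; apply/negP.
have [p pi Up] := block_vector_neq0 ui; have [q qj Uq] := block_vector_neq0 uj.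
apply: (mulIf (_ : U p i * (U q j)^* != 0)).
  by rewrite mulf_neq0 ?conjC_eq0.
by rewrite -(cA _ _ _ _ pi qj) (cA' _ _ _ _ pi qj).
Qed.

(** Choosing an index [r i] in each block gives a formula for the coefficient
    matrix; by [block_coefficients_unique] the choice is immaterial. *)

Section Representatives.
Variable r : 'I_k -> 'I_N.
Hypothesis rI : forall i, r i \in I i.

Let d i := U (r i) i.

(** For a zero block the denominator is 0, and [x / 0 = 0] is the value that
    [block_coefficients] prescribes. *)
Definition correlation : 'M[R[i]]_k := \matrix_(i, j) (A (r i) (r j) / (d i * (d j)^*)).
Local Notation c := correlation.

Let rep_entry i j : A (r i) (r j) = c i j * (d i * (d j)^*).
Proof.
case: (hA) => _ hermA posA; rewrite mxE.
have [di0|di_neq0] := eqVneq (d i) 0.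
  rewrite di0 mul0r mulr0 (psd_diag_eq0 hermA posA) //.
  by rewrite (scatter_factor (rI i) (rI i)) -/(d i) di0 mul0r.
have [dj0|dj_neq0] := eqVneq (d j) 0.
  rewrite dj0 conjC0 !mulr0 herm (psd_diag_eq0 hermA posA) ?conjC0 //.
  by rewrite (scatter_factor (rI j) (rI j)) -/(d j) dj0 mul0r.
by rewrite mulfVK // mulf_neq0 ?conjC_eq0.
Qed.

Lemma correlation_orbit i j p q : p \in I i -> q \in I j ->
  A p q = c i j * (U p i * (U q j)^*) /\ orbit_of G (A (r i) (r j)) (A p q).
Proof.
case: hG => _ _ GM _ pi qj.
have [g [Gg _ Ap Up]] := scatter_multiplier pi (rI i).
have [h [_ Gh Aq Uq]] := scatter_multiplier qj (rI j).
have Apq : A p q = A (r i) (r j) * (g * h^*).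
  by rewrite Ap herm Aq rmorphM /= -herm; ring.
split; last by exists (g * h^*); [apply: GM|].
by rewrite Apq Up Uq rmorphM rep_entry /= /d; ring.
Qed.

Lemma correlation_block_coefficients : block_coefficients A u c.
Proof.
split; last by apply/block_factorP=> i j p q pi qj; have [] := correlation_orbit pi qj.
have d0 i : u i = 0 -> d i = 0.
  rewrite /d; have [a <-] := mem_enum_val (rI i).
  by rewrite scatter_enum_val => ->; rewrite mxE.
move=> i j /(introN andP); rewrite negb_and !negbK mxE.
by case/orP=> /eqP/d0 ->; rewrite ?conjC0 ?mul0r ?mulr0 invr0 mulr0.
Qed.

(* A row of [X] for a zero block is zero, again because [x / 0 = 0]. *)
Let X : 'M[R[i]]_(k, N) := \matrix_(i, p) ((p == r i)%:R / d i).

Let correlationE : c = X *m A *m X ^t*.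
Proof.
have XE m i (B : 'M_(N, m)) q : (X *m B) i q = B (r i) q / d i.
  rewrite mxE (bigD1 (r i)) //= big1 => [|p /negPf p_neq]; last by rewrite mxE p_neq !mul0r.
  by rewrite mxE eqxx addr0 mul1r mulrC.
have XtE m (B : 'M_(m, N)) p j : (B *m X ^t*) p j = B p (r j) / (d j)^*.
  rewrite mxE (bigD1 (r j)) //= big1 => [|q /negPf q_neq].
    by rewrite !mxE eqxx addr0 mul1r fmorphV.
  by rewrite !mxE q_neq mul0r conjC0 mulr0.
by apply/matrixP=> i j; rewrite XtE XE mxE -mulrA -invfM.
Qed.

Let scatterE : A = U *m c *m U ^t*.
Proof.
apply/matrixP=> p q.
have [i pi] := family_partition_cover partI p; have [j qj] := family_partition_cover partI q.
have out x l l' : x \in I l -> l' != l -> U x l' = 0.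
  move=> xl neq; apply: scatter_out; apply: contraNN neq => xl'.
  by apply/eqP; apply: family_partition_inj partI _ _ _ xl' xl.
have UtE l x : (U ^t*) l x = (U x l)^* by rewrite [LHS]mxE; congr (_^*); rewrite mxE.
rewrite mxE (bigD1 j) //= big1 => [|l lj]; last by rewrite UtE (out _ _ _ qj lj) conjC0 mulr0.
rewrite addr0 mxE (bigD1 i) //= big1 => [|l li]; last by rewrite (out _ _ _ pi li) mul0r.
by have [-> _] := correlation_orbit pi qj; rewrite UtE; ring.
Qed.

Lemma rank_correlation : \rank A = \rank c.
Proof.
have rank_congr m n (B : 'M[R[i]]_m) (L : 'M_(n, m)) (M : 'M_(m, n)) :
    (\rank (L *m B *m M) <= \rank B)%N.
  exact: leq_trans (mxrankM_maxl _ _) (mxrankM_maxr _ _).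
apply/eqP; rewrite eqn_leq; apply/andP; split.
  by rewrite [X in (\rank X <= _)%N]scatterE.
by rewrite [X in (\rank X <= _)%N]correlationE.
Qed.

Lemma psd_correlation : psd_over (@closed_unit_disc R) c.
Proof.
case: (hA) => _ hermA posA.
have hermc : c ^t* = c.
  apply/matrixP=> i j; rewrite !mxE rmorphM fmorphV rmorphM /= conjCK -herm.
  by congr (_ * _^-1); apply: mulrC.
have posc (v : 'cV_k) : 0 <= (v ^t* *m c *m v) 0 0.
  have XK : (X ^t*) ^t* = X by apply/matrixP=> i j; rewrite !mxE conjCK.
  by have := posA (X ^t* *m v); rewrite correlationE trmx_mul map_mxM XK !mulmxA.
split=> // i j; rewrite /closed_unit_disc /=.
have cii l : c l l <= 1.
  rewrite mxE (scatter_factor (rI l) (rI l)) -/(d l).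
  by have [->|d_neq0] := eqVneq (d l) 0; rewrite ?mul0r ?ler01 //
     divff // mulf_neq0 ?conjC_eq0.
have cii0 l := psd_diag_ge0 posc l.
rewrite -(@expr_le1 _ 2) // (le_trans (psd_entry_CauchySchwarz hermc posc i j)) //.
by rewrite mulr_ile1.
Qed.

End Representatives.
End BlockFactorization.

(** * Maximal blocks are row-equivalence classes *)

Section MaximalBlocks.
Variables (R : realType) (G : set R[i]) (N : nat) (A : 'M[R[i]]_N).
Hypotheses (hG : mul_subgroup G) (hA : psd_over setT A).

(** A homogeneous block is contained in the class of any of its elements, and
    that class is homogeneous, so maximality forces equality. *)
Lemma maximal_blocks_row_class k (I : 'I_k -> {set 'I_N})
    (u : forall j : 'I_k, 'cV[R[i]]_#|I j|) j p :
  rank_one_blocks A u -> single_orbit_blocks G A I -> maximal_blocks G A I ->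
  p \in I j -> I j = row_class G A p.
Proof.
move=> rank1 orb max pj; apply/eqP; rewrite eqEproper; apply/andP; split.
  have [rk _] := rank1 j; have /(homogeneousP hG hA) eqJ := conj rk (orb j).
  by apply/fintype.subsetP=> q qj; rewrite !inE; apply: eqJ.
apply/negP=> sub; apply: (max j); exists (row_class G A p).
have /(homogeneousP hG hA)[] := row_class_homogeneous hG (A := A) (p := p).
by split.
Qed.

(** Only the map is given here; applying this in both directions yields two
    maps which are mutually inverse because the families are injective. *)
Lemma maximal_blocks_match k (I : 'I_k -> {set 'I_N})
    (u : forall j : 'I_k, 'cV[R[i]]_#|I j|)
    k' (I' : 'I_k' -> {set 'I_N}) (u' : forall j : 'I_k', 'cV[R[i]]_#|I' j|) :
  [/\ family_partition I, rank_one_blocks A u, single_orbit_blocks G A I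
    & maximal_blocks G A I] ->
  [/\ family_partition I', rank_one_blocks A u', single_orbit_blocks G A I'
    & maximal_blocks G A I'] ->
  exists s : 'I_k -> 'I_k', forall j, I' (s j) = I j.
Proof.
move=> [part rk orb max] [part' rk' orb' max'].
suff /choice[s sP] : forall j, exists j', I' j' = I j by exists s.
move=> j; have [p pj] := family_partition_neq0 part j.
have [j' pj'] := family_partition_cover part' p; exists j'.
by rewrite (maximal_blocks_row_class rk orb max pj)
  (maximal_blocks_row_class rk' orb' max' pj').
Qed.

Lemma homogeneous_factor_unique (J : {set 'I_N}) p : p \in J ->
  {in J &, forall p q, row_equiv G A p q} ->
  exists u, unique (normalized_factor (subblock A J J)) u.
Proof.
case: (hA) => _ hermA posA pJ eqJ.
have J_gt0 : (0 < #|J|)%N by rewrite card_gt0; apply/finset.set0Pn; exists p.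
pose i0 := Ordinal J_gt0.
have herm x y := herm_entry hermA x y.
apply: (normalized_factor_unique (p0 := i0)) => //.
- by apply/matrixP=> i j; rewrite !mxE -herm.
- by rewrite mxE; apply: psd_diag_ge0.
move=> i j; rewrite !mxE; set p0 := enum_val i0.
have [g [_ _ Ai]] := eqJ _ _ (enum_valP i) (enum_valP i0).
rewrite !Ai -/p0; have [a0|a_neq0] := eqVneq (A p0 p0) 0.
  by rewrite a0 (psd_diag_eq0 hermA posA) // !(mulr0, mul0r).
by field.
Qed.

Lemma maximal_partition_exists :
  exists (k : nat) (I : 'I_k -> {set 'I_N}) (u : forall j : 'I_k, 'cV[R[i]]_#|I j|),
     [/\ family_partition I, rank_one_blocks A u, single_orbit_blocks G A I
       & maximal_blocks G A I].
Proof.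
pose e p q := `[< row_equiv G A p q >].
pose P := equivalence_partition e [set: 'I_N].
have eqve : {in [set: 'I_N] & &, equivalence_rel e}.
  move=> p q r _ _ _; split; first exact/asboolP/row_equiv_refl.
  move=> /asboolP pq; apply/asboolP/asboolP; apply: row_equiv_trans => //.
  exact: row_equiv_sym.
have partP := equivalence_partitionP eqve.
have classP J : J \in P -> exists p, J = row_class G A p.
  by case/imsetP=> p _ ->; exists p; apply/setP=> q; rewrite !inE.
pose I (j : 'I_#|P|) : {set 'I_N} := enum_val j.
have classI j : exists p, I j = row_class G A p by apply/classP/enum_valP.
have homI j : {in I j &, forall x y, row_equiv G A x y}.
  by have [p ->] := classI j; apply: row_class_homogeneous.
have exu j : exists u, unique (normalized_factor (subblock A (I j) (I j))) u.
  have [p Ij] := classI j; apply: (homogeneous_factor_unique (p := p)) => //.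
  by rewrite Ij mem_row_class.
exists #|P|, I, (fun j => projT1 (cid (exu j))); split.
- split; first exact: enum_val_inj.
  suff -> : [set I j | j : 'I_#|P|]%SET = P by [].
  apply/setP=> J; apply/imsetP/idP => [[j _ ->]|/mem_enum_val[j <-]].
    exact: enum_valP.
  by exists j.
- move=> j; split; last by case: (cid (exu j)).
  by have /(homogeneousP hG hA)[] := homI j.
- by move=> j; have /(homogeneousP hG hA)[] := homI j.
move=> j [J [/properP[sub [q qJ qNj]] rk orb]].
have /(homogeneousP hG hA) eqJ := conj rk orb.
case/negP: qNj; have [p Ij] := classI j.
have pj : p \in I j by rewrite Ij mem_row_class.
by rewrite Ij !inE; apply: eqJ => //; apply: (fintype.subsetP sub).
Qed.

(** If [c i j] had modulus one, equality in Cauchy-Schwarz for non-zero entries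
    in the two blocks would be a vanishing minor; the orbit condition is void
    for non-zero numbers, so the two blocks would be the same class. *)
Lemma maximal_blocks_open_disc k (I : 'I_k -> {set 'I_N})
    (u : forall j : 'I_k, 'cV[R[i]]_#|I j|) (c : 'M[R[i]]_k) :
  G = @nonzero_complex R ->
  [/\ family_partition I, rank_one_blocks A u, single_orbit_blocks G A I
    & maximal_blocks G A I] ->
  block_coefficients A u c ->
  forall i j : 'I_k, i != j -> open_unit_disc (c i j).
Proof.
case: (hA) => _ hermA posA GE [part rk orb max] [c0 cA] i j ij.
rewrite /open_unit_disc /=.
have [/andP[ui uj]|uij0] := boolP ((u i != 0) && (u j != 0)); last first.
  by rewrite c0 ?normr0 ?ltr01 // => /andP; apply/negP.
have {}cA := (block_factorP A u c).1 cA.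
have [p pi Up] := block_vector_neq0 ui; have [q qj Uq] := block_vector_neq0 uj.
have Apq := cA _ _ _ _ pi qj.
have App : A p p = `|scatter u p i| ^+ 2 by rewrite normCK; apply: scatter_factor.
have Aqq : A q q = `|scatter u q j| ^+ 2 by rewrite normCK; apply: scatter_factor.
have App_neq0 : A p p != 0 by rewrite App expf_neq0 ?normr_eq0.
have Aqq_neq0 : A q q != 0 by rewrite Aqq expf_neq0 ?normr_eq0.
have Dpq : `|A p q| ^+ 2 = `|c i j| ^+ 2 * (A p p * A q q).
  by rewrite Apq !normrM norm_conjC App Aqq; ring.
have pos : 0 < A p p * A q q.
  by rewrite mulr_gt0 // lt0r ?App_neq0 ?Aqq_neq0 psd_diag_ge0.
have c_le1 : `|c i j| <= 1.
  rewrite -(@expr_le1 _ 2) // -(ler_pM2r pos) mul1r -Dpq.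
  exact: psd_entry_CauchySchwarz.
rewrite lt_neqAle c_le1 andbT; apply/negP=> /eqP c1.
have minor0 : A p p * A q q = A p q * A q p.
  by rewrite (herm_entry hermA p q) -normCK Dpq c1 expr1n mul1r.
have pq : row_equiv G A p q.
  apply: (row_equiv_minor hG hA) => // [/eqP|_]; first by rewrite (negPf Aqq_neq0).
  have Apq_neq0 : A p q != 0 /\ A q p != 0.
    by apply/andP; rewrite -negb_or -mulf_eq0 -minor0 mulf_neq0.
  by rewrite GE /nonzero_complex /= !mulf_neq0 ?invr_neq0 //; case: Apq_neq0.
have qi : q \in I i by rewrite (maximal_blocks_row_class rk orb max pi) !inE.
by case/eqP: ij; apply: family_partition_inj part _ _ _ qi qj.
Qed.

End MaximalBlocks.

(** * The main theorem *)

Theorem theorem5p1 (R : realType) (G : set R[i]) (hG : mul_subgroup G)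
    (N : nat) (hN : (1 <= N)%N) (A : 'M[R[i]]_N)
    (hA : psd_over setT A) (hA0 : A != 0) :
  [/\
   (forall (k : nat) (I : 'I_k -> {set 'I_N})
       (u : forall j : 'I_k, 'cV[R[i]]_#|I j|),
     family_partition I -> rank_one_blocks A u -> single_orbit_blocks G A I ->
     exists c : 'M[R[i]]_k,
       [/\ unique (block_coefficients A u) c,
           forall i j : 'I_k, i != j ->
             in_single_orbit G (subblock A (I i) (I j)),
           psd_over (@closed_unit_disc R) c
         & \rank A = \rank c]),
   (exists (k : nat) (I : 'I_k -> {set 'I_N})
       (u : forall j : 'I_k, 'cV[R[i]]_#|I j|),
     [/\ family_partition I, rank_one_blocks A u, single_orbit_blocks G A I
       & maximal_blocks G A I]) /\
   (forall (k : nat) (I : 'I_k -> {set 'I_N})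
       (u : forall j : 'I_k, 'cV[R[i]]_#|I j|)
       (k' : nat) (I' : 'I_k' -> {set 'I_N})
       (u' : forall j : 'I_k', 'cV[R[i]]_#|I' j|),
     [/\ family_partition I, rank_one_blocks A u, single_orbit_blocks G A I
       & maximal_blocks G A I] ->
     [/\ family_partition I', rank_one_blocks A u', single_orbit_blocks G A I'
       & maximal_blocks G A I'] ->
     exists s : 'I_k -> 'I_k', bijective s /\ forall j, I' (s j) = I j)
   & (G = @nonzero_complex R ->
     forall (k : nat) (I : 'I_k -> {set 'I_N})
       (u : forall j : 'I_k, 'cV[R[i]]_#|I j|) (c : 'M[R[i]]_k),
     [/\ family_partition I, rank_one_blocks A u, single_orbit_blocks G A I
       & maximal_blocks G A I] ->
     block_coefficients A u c ->
     forall i j : 'I_k, i != j -> open_unit_disc (c i j))].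
Proof.
split.
- move=> k I u part rk orb.
  have [r rI] := choice (family_partition_neq0 part).
  have cA := correlation_block_coefficients hG hA rk orb rI.
  exists (correlation A u r); split.
  + by split=> // c' cA'; apply: block_coefficients_unique cA cA'.
  + move=> i j _; exists (A (r i) (r j)) => a b; rewrite mxE.
    by have [] := correlation_orbit hG hA rk orb rI (enum_valP a) (enum_valP b).
  + exact: (psd_correlation hA rk rI).
  + exact: (rank_correlation hG hA part rk orb rI).
- split; first exact: maximal_partition_exists.
  move=> k I u k' I' u' max max'.
  have [s sP] := maximal_blocks_match hG hA max max'.
  have [t tP] := maximal_blocks_match hG hA max' max.
  have [[injI _] _ _ _] := max; have [[injI' _] _ _ _] := max'.
  exists s; split=> //; exists t => j; first by apply: injI; rewrite tP sP.
  by apply: injI'; rewrite sP tP.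
- by move=> GE k I u c; apply: maximal_blocks_open_disc GE.
Qed.
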